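(* Let $X_P$ be a toric Fano variety associated to a polytope $P$ with Ricci affine function $\ell_P$. Then: (1) $X_P$ is relatively D-stable if and only if $\inf_P\ell_P\ge0$. (2) $X_P$ is uniformly relative D-stable if and only if $\inf_P\ell_P>0$; $X_P$ is non-uniformly relative D-stable if and only if $\inf_P\ell_P=0$. (3) $X_P$ is relatively D-unstable if and only if $\inf_P\ell_P<0$.
   Context: Let $N$ be a lattice of rank $n$ with dual $M$. A Fano polytope $Q\subset N_{\mathbb R}$ has $0$ in its interior and vertices $q_\alpha$ primitive in $N$; $P=\{y\in M_{\mathbb R}\cong\mathbb R^n\mid\langle q_\alpha,y\rangle+1\ge0\ \forall\alpha\}$; the toric Fano variety $X_P$ is the toric variety of the fan spanned by the proper faces of $Q$. $V_P$ is the Lebesgue volume of $P$. The Ricci affine function $\ell_P$ is the unique affine function with $-h(0)+\int_Ph\,\ell_P\,dy=0$ for all affine $h$. A rational PL convex function on $P$ is a maximum of finitely many affine functions with rational coefficients. For integrable convex $f$ on $P$, $D_\ell^{\mathrm{NA}}(f)=-f(0)+\int_Pf\,\ell_P\,dy$ and $J^T(f)=\inf\{\frac1{V_P}\int_P(f-l)dy-\inf_P(f-l)\mid l\text{ affine}\}$. $X_P$ (equivalently $P$) is: relatively D-stable if $D_\ell^{\mathrm{NA}}(f)\ge0$ for every rational PL convex $f$ on $P$, with equality only when $f$ is affine; relatively D-unstable if $D_\ell^{\mathrm{NA}}(f)<0$ for some rational PL convex $f$; uniformly relative D-stable if there is $\delta>0$ with $D_\ell^{\mathrm{NA}}(f)\ge\delta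 J^T(f)$ for all rational PL convex $f$; non-uniformly relative D-stable if it is relatively D-stable but not uniformly. *)

(* Defs.v *)
From HB Require Import structures.
From mathcomp Require Import all_boot all_order all_algebra.
From mathcomp Require Import all_classical all_reals all_analysis.

Set Implicit Arguments.
Unset Strict Implicit.
Unset Printing Implicit Defensive.
Import Order.TTheory GRing.Theory Num.Theory.
Import numFieldNormedType.Exports.

Local Open Scope classical_set_scope.
Local Open Scope ring_scope.

(* Row vectors carry the sigma-algebra generated by the coordinates, i.e. the
   Borel sets of R^n, exactly as the library does for tuples. *)

Section measurable_rV.
Context {R : realType}.
Variable n : nat.

Let coord : 'I_n -> 'rV[R]_n -> R := fun i v => v ord0 i.

Let rV_set0 : g_sigma_preimage coord set0.
Proof. exact: sigma_algebra0. Qed.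

Let rV_setC A : g_sigma_preimage coord A -> g_sigma_preimage coord (~` A).
Proof. exact: sigma_algebraC. Qed.

Let rV_bigcup (F : (set 'rV[R]_n)^nat) :
  (forall i, g_sigma_preimage coord (F i)) ->
  g_sigma_preimage coord (\bigcup_i (F i)).
Proof. exact: sigma_algebra_bigcup. Qed.

HB.instance Definition _ :=
  @isMeasurable.Build (measure_tuple_display default_measure_display)
    'rV[R]_n (g_sigma_preimage coord) rV_set0 rV_setC rV_bigcup.

Lemma measurable_coord (i : 'I_n) :
  measurable_fun [set: 'rV[R]_n] (fun v : 'rV[R]_n => v ord0 i).
Proof.
move=> _ Y mY; rewrite setTI; apply: sub_sigma_algebra => /=.
rewrite -bigcup_seq/=; exists i => /=; first by rewrite mem_index_enum.
by exists Y => //; rewrite setTI.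
Qed.

End measurable_rV.

Lemma measurable_rVP (R : realType) (n : nat) d (T : measurableType d)
    (f : T -> 'rV[R]_n) :
  (forall i, measurable_fun [set: T] (fun t => f t ord0 i)) ->
  measurable_fun [set: T] f.
Proof.
move=> mf; apply: (@measurability _ _ _ _ _ _
  (\big[setU/set0]_(i < n) preimage_set_system setT
     (fun v : 'rV[R]_n => v ord0 i) measurable)) => //.
move=> _ [B + <-]; rewrite -bigcup_seq => -[i _ [A mA <-]].
by rewrite [X in _ `&` (_ @^-1` X)]setTI; exact: (mf i).
Qed.

Section rV_cons.
Context {R : realType}.
Variable n : nat.

Definition rV_cons (p : R * 'rV[R]_n) : 'rV[R]_n.+1 :=
  row_mx (const_mx p.1 : 'rV[R]_1) p.2.

Lemma rV_cons0 p : rV_cons p ord0 ord0 = p.1.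
Proof.
transitivity ((const_mx p.1 : 'rV[R]_1) ord0 ord0); last by rewrite mxE.
rewrite -(row_mxEl (const_mx p.1) p.2).
by congr (rV_cons p ord0 _); exact/val_inj.
Qed.

Lemma rV_consS p (i : 'I_n) : rV_cons p ord0 (lift ord0 i) = p.2 ord0 i.
Proof.
rewrite -(row_mxEr (const_mx p.1 : 'rV[R]_1) p.2 ord0 i).
by congr (rV_cons p ord0 _); exact/val_inj.
Qed.

Lemma measurable_rV_cons : measurable_fun [set: R * 'rV[R]_n] rV_cons.
Proof.
apply/measurable_rVP => i; have [j ->|->] := unliftP ord0 i.
  rewrite (_ : (fun _ => _) = (fun v : 'rV[R]_n => v ord0 j) \o snd).
    exact: measurableT_comp (measurable_coord j) _.
  by apply/funext => p /=; rewrite rV_consS.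
rewrite (_ : (fun _ => _) = fst); first exact: measurable_fst.
by apply/funext => p /=; rewrite rV_cons0.
Qed.

End rV_cons.

Section lebesgue_rV_step.
Context {R : realType}.
Variable n : nat.
Variable m : {sigma_finite_measure set 'rV[R]_n -> \bar R}.
Local Open Scope ereal_scope.

Let mu : {sigma_finite_measure set (measurableTypeR R) -> \bar R} :=
  lebesgue_measure.
Let prod_m : {measure set _ -> \bar R} := mu \x m.

Definition lebesgue_rV_step : set 'rV[R]_n.+1 -> \bar R :=
  pushforward (lebesgue_measure \x m) (@rV_cons R n).

Let preimage_measurable (A : set 'rV[R]_n.+1) :
  measurable A -> measurable (@rV_cons R n @^-1` A).
Proof.
by move=> mA; rewrite -[X in measurable X]setTI; exact: measurable_rV_cons.
Qed.

Let step0 : lebesgue_rV_step set0 = 0.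
Proof.
by rewrite /lebesgue_rV_step /pushforward preimage_set0; exact: (measure0 prod_m).
Qed.

Let step_ge0 A : 0 <= lebesgue_rV_step A.
Proof. exact: (measure_ge0 prod_m). Qed.

Let step_sigma_additive : semi_sigma_additive lebesgue_rV_step.
Proof.
move=> F mF tF mUF; rewrite /lebesgue_rV_step /pushforward preimage_bigcup.
apply: (@measure_semi_sigma_additive _ _ _ prod_m).
- by move=> i; exact: preimage_measurable.
- apply/trivIsetP => /= i j _ _ ij; rewrite -preimage_setI.
  by move/trivIsetP : tF => /(_ _ _ _ _ ij) ->//; rewrite preimage_set0.
- by rewrite -preimage_bigcup; exact: preimage_measurable.
Qed.

HB.instance Definition _ := isMeasure.Build _ _ _ lebesgue_rV_step
  step0 step_ge0 step_sigma_additive.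

Let step_sigma_finite : sigma_finite setT lebesgue_rV_step.
Proof.
have /sigma_finiteP[F [TF ndF Foo]] :=
sigma_finiteT mu.
have /sigma_finiteP[G [TG ndG Goo]] := sigma_finiteT m.
pose H k : set 'rV[R]_n.+1 :=
  [set v | F k (v ord0 ord0) /\ G k (\row_i v ord0 (lift ord0 i))].
have consH k : @rV_cons R n @^-1` (H k) = F k `*` G k.
  apply/seteqP; split=> -[x w]; rewrite /H /= rV_cons0 /= => -[Fx Gw]; split=> //.
    suff <- : (\row_i rV_cons (x, w) ord0 (lift ord0 i))%R = w by [].
    by apply/rowP => i; rewrite mxE rV_consS.
  suff -> : (\row_i rV_cons (x, w) ord0 (lift ord0 i))%R = w by [].
  by apply/rowP => i; rewrite mxE rV_consS.
exists H.
  apply/seteqP; split=> // v _.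
  have [i _ Fi] : (\bigcup_i F i) (v ord0 ord0) by rewrite -TF.
  have [j _ Gj] : (\bigcup_i G i) (\row_i v ord0 (lift ord0 i))%R by rewrite -TG.
  exists (maxn i j) => //; split.
    by move: Fi; exact/subsetPset/ndF/leq_maxl.
  by move: Gj; exact/subsetPset/ndG/leq_maxr.
move=> k; have [mF Fk] := Foo k; have [mG Gk] := Goo k; split.
  have mtail : measurable_fun [set: 'rV[R]_n.+1]
      (fun v => \row_i v ord0 (lift ord0 i) : 'rV[R]_n)%R.
    apply/measurable_rVP => i.
    rewrite (_ : (fun _ => _) = (fun v : 'rV[R]_n.+1 => v ord0 (lift ord0 i))).
      exact: measurable_coord.
    by apply/funext => v; rewrite mxE.
  apply: measurableI.
    by rewrite -[X in measurable X]setTI; exact: measurable_coord.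
  by rewrite -[X in measurable X]setTI; exact: mtail.
rewrite /lebesgue_rV_step /pushforward consH (@product_measure1E _ _ _ _ _ mu)//.
by rewrite lte_mul_pinfty// ge0_fin_numE.
Qed.

HB.instance Definition _ := Measure_isSigmaFinite.Build _ _ _ lebesgue_rV_step
  step_sigma_finite.

End lebesgue_rV_step.

(* The n-fold product of the Lebesgue measure of R (see lebesgue_rV_box). *)
Fixpoint lebesgue_rV (R : realType) (n : nat) :
    {sigma_finite_measure set 'rV[R]_n -> \bar R} :=
  if n is k.+1 then lebesgue_rV_step (lebesgue_rV R k)
  else dirac (0 : 'rV[R]_0).

Lemma lebesgue_rV_box (R : realType) (n : nat)
    (A : 'I_n -> set R) :
  (forall i, measurable (A i)) ->
  lebesgue_rV R n [set v : 'rV[R]_n | forall i, A i (v ord0 i)] =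
  (\big[*%E/1]_(i < n) lebesgue_measure (A i))%E.
Proof.
elim: n A => [|n IH] A mA.
  by rewrite big_ord0 /= diracE mem_set// => -[].
pose B := [set v : 'rV[R]_n | forall i, A (lift ord0 i) (v ord0 i)].
have mB : measurable B.
  have -> : B = \bigcap_(i in [set: 'I_n])
      ((fun v : 'rV[R]_n => v ord0 i) @^-1` A (lift ord0 i)).
    by apply/seteqP; split=> [v Av i _|v Av i]; exact: Av.
  apply: fin_bigcap_measurable => [|i _]; first exact: finite_finset.
  by rewrite -[X in measurable X]setTI; exact: measurable_coord.
rewrite big_ord_recl -IH//= /lebesgue_rV_step /pushforward -/B.
have -> : @rV_cons R n @^-1` [set v | forall i, A i (v ord0 i)] = A ord0 `*` B.
  apply/seteqP; split=> -[x w] /=.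
    move=> Aw; split; first by have := Aw ord0; rewrite rV_cons0.
    by move=> i; have := Aw (lift ord0 i); rewrite rV_consS.
  case=> /= Ax Aw i; have [j ->|->] := unliftP ord0 i.
    by rewrite rV_consS; exact: Aw.
  by rewrite rV_cons0.
by rewrite (@product_measure1E _ _ _ _ _ (lebesgue_measure :
  {sigma_finite_measure set (measurableTypeR R) -> \bar R}))//; exact: mA.
Qed.

(* A basis of the lattice N and its dual basis identify N and M with Z^n, both
   N_R and M_R with R^n, and the duality bracket with the dot product. *)

Section fano.
Variables (R : realType) (n : nat).
Implicit Types (Q P : set 'rV[R]_n) (f l : 'rV[R]_n -> R).

Definition pairing (x y : 'rV[R]_n) : R := \sum_(i < n) x ord0 i * y ord0 i.

Definition polytope Q :=
  exists S : seq 'rV[R]_n, Q = smallest (@convex_set R 'rV[R]_n) [set` S].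

Definition vertex Q (v : 'rV[R]_n) :=
  Q v /\ forall (a b : 'rV[R]_n) (t : R), Q a -> Q b -> 0 < t < 1 ->
    v = t *: a + (1 - t) *: b -> a = v /\ b = v.

Definition primitive (q : 'rV[int]_n) :=
  q != 0 /\ forall (k : int) (w : 'rV[int]_n), q = k *: w -> `|k| = 1.

Definition fano_polytope Q :=
  [/\ polytope Q, interior Q 0 &
      forall v, vertex Q v ->
        exists2 q : 'rV[int]_n, primitive q & v = map_mx intr q].

(* The fan over the proper faces of Q, hence the toric Fano variety X_P, is
   determined by Q; its stability is by definition a property of the polytope
   P := dual_polytope Q and of its Ricci affine function. *)
Definition dual_polytope Q : set 'rV[R]_n :=
  [set y | forall q, vertex Q q -> 0 <= pairing q y + 1].

Definition affine l := exists a b, forall y, l y = pairing a y + b.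

Definition affine_on P f := exists2 l, affine l & forall y, P y -> f y = l y.

Definition rational_affine l :=
  exists (a : 'rV[rat]_n) (b : rat),
    forall y, l y = pairing (map_mx ratr a) y + ratr b.

(* Only the restriction of f to P matters, here and in D_NA and J_T (0 is a
   point of P). *)
Definition rational_PL_convex P f :=
  exists (k : nat) (l : 'I_k.+1 -> 'rV[R]_n -> R),
    (forall i, rational_affine (l i)) /\
    forall y, P y -> f y = \big[Num.max/l ord0 y]_(i < k.+1) l i y.

Definition D_NA P (ell f : 'rV[R]_n -> R) : R :=
  - f 0 + \int[lebesgue_rV R n]_(y in P) (f y * ell y).

Definition ricci_affine P (ell : 'rV[R]_n -> R) :=
  affine ell /\ forall h, affine h -> D_NA P ell h = 0.

Definition J_T P f : R :=
  let V := fine (lebesgue_rV R n P) in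
  inf [set V^-1 * \int[lebesgue_rV R n]_(y in P) (f y - l y)
         - inf [set f y - l y | y in P] | l in affine].

Definition relatively_D_stable P ell :=
  forall f, rational_PL_convex P f ->
    0 <= D_NA P ell f /\ (D_NA P ell f = 0 -> affine_on P f).

Definition relatively_D_unstable P ell :=
  exists2 f, rational_PL_convex P f & D_NA P ell f < 0.

Definition uniformly_relative_D_stable P ell :=
  exists2 delta : R, 0 < delta &
    forall f, rational_PL_convex P f -> delta * J_T P f <= D_NA P ell f.

Definition non_uniformly_relative_D_stable P ell :=
  relatively_D_stable P ell /\ ~ uniformly_relative_D_stable P ell.

End fano.

(* Main.v *)
Require Import Defs.
From mathcomp Require Import all_boot all_order all_algebra.
From mathcomp Require Import all_classical all_reals all_analysis.
From mathcomp Require Import measurable_realfun ring lra.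

Set Implicit Arguments.
Unset Strict Implicit.
Unset Printing Implicit Defensive.
Import Order.TTheory GRing.Theory Num.Theory.
Import numFieldNormedType.Exports.

Local Open Scope classical_set_scope.
Local Open Scope ring_scope.

(** The toric variety enters only through P, a bounded polyhedron with 0 in its
    interior, and through the two consequences of the defining property of the
    Ricci affine function ell that drive every argument: D_NA does not change
    when an affine function is subtracted from f, and the integral of ell over
    P is 1.

    A rational PL convex f has a supporting affine function l at 0, with
    l <= f on P and l 0 = f 0. Subtracting it removes the Dirac term, so that
    D_NA f is the integral of (f - l) * ell (D_NA_support). All the stability
    statements follow from the sign of ell in that integral.

    If inf ell >= 0 the integrand is nonnegative, hence D_NA f >= 0. If
    D_NA f = 0 but f p > l p at some p in P, take a supporting function k at p:
    (k - l) * ell is positive on an open set close to p, because k - l > 0 at p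
    while ell is nonnegative at p and positive at 0 (ricci0_gt0), and P is
    convex. The integral would then be positive (D_NA_eq0_affine).

    If inf ell = m > 0 then D_NA f >= m * int (f - l), and l is a competitor in
    the infimum defining J_T f, so D_NA f >= m * V * J_T f
    (uniform_D_NA_ge).

    If ell is negative somewhere, f = max(0, - ell) would give
    D_NA f <= - int f^2 < 0, and a rational approximation of - ell on P keeps
    the sign (exists_destabilizing).

    If inf ell = 0, the functions f = max(0, h) with h rational and close to
    2 e - ell violate any uniform bound (exists_small_D_NA). They live where
    ell < 3 e, so D_NA f <= 3 e int f; on the other hand, evaluating at the
    barycenter of P, where ell takes the value 1 / V > 0 and f therefore
    vanishes, shows that J_T f is at least the average of f
    (J_T_ge_average). *)

(** * Affine functions *)

Section affine_functions.
Variables (R : realType) (n : nat).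
Implicit Types (a x y : 'rV[R]_n) (u v : 'rV[R]_n -> R).

Lemma pairingC x y : pairing x y = pairing y x.
Proof. by apply: eq_bigr => i _; rewrite mulrC. Qed.

Lemma pairingDr a x y : pairing a (x + y) = pairing a x + pairing a y.
Proof. by rewrite -big_split; apply: eq_bigr => i _; rewrite mxE mulrDr. Qed.

Lemma pairingZr a (t : R) x : pairing a (t *: x) = t * pairing a x.
Proof. by rewrite mulr_sumr; apply: eq_bigr => i _; rewrite mxE mulrCA. Qed.

Lemma pairing0r a : pairing a 0 = 0.
Proof. by rewrite -(scale0r 0) pairingZr mul0r. Qed.

Lemma pairing_combl a b y (t : R) :
  pairing (t *: a + (1 - t) *: b) y = t * pairing a y + (1 - t) * pairing b y.
Proof. by rewrite !(pairingC _ y) pairingDr !pairingZr. Qed.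

Lemma pairing_self_ge0 x : 0 <= pairing x x.
Proof. by apply: sumr_ge0 => i _; rewrite -expr2 sqr_ge0. Qed.

Lemma pairing_self_eq0 x : pairing x x <= 0 -> x = 0.
Proof.
move=> x0; have /eqP := le_anti (introT andP (conj x0 (pairing_self_ge0 x))).
rewrite psumr_eq0 => [/allP xi0|i _]; last by rewrite -expr2 sqr_ge0.
apply/rowP => i; rewrite mxE; apply/eqP.
by have := xi0 i; rewrite mem_index_enum mulf_eq0 orbb => /(_ isT).
Qed.

Lemma affine_cst (c : R) : affine (fun _ : 'rV[R]_n => c).
Proof.
exists 0, c => y; rewrite /pairing big1 ?add0r// => i _.
by rewrite mxE mul0r.
Qed.

Lemma affine_coord (i : 'I_n) : affine (fun y : 'rV[R]_n => y ord0 i).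
Proof.
exists (delta_mx ord0 i), 0 => y; rewrite addr0 /pairing (bigD1 i)//= big1.
  by rewrite mxE !eqxx mul1r addr0.
by move=> j /negPf ji; rewrite mxE ji andbF mul0r.
Qed.

Lemma affine_halfspace a : affine (fun y => pairing a y + 1).
Proof. by exists a, 1. Qed.

Lemma affineZ u (t : R) : affine u -> affine (fun y => t * u y).
Proof.
by move=> [a [b uE]]; exists (t *: a), (t * b) => y;
  rewrite uE [in RHS]pairingC pairingZr mulrDr pairingC.
Qed.

Lemma affineD u v : affine u -> affine v -> affine (fun y => u y + v y).
Proof.
move=> [a [b uE]] [c [d vE]]; exists (a + c), (b + d) => y.
by rewrite uE vE [in RHS]pairingC pairingDr !(pairingC y) addrACA.
Qed.

Lemma affineN u : affine u -> affine (fun y => - u y).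
Proof.
move=> /(affineZ (-1)); congr affine.
by apply/funext => y; rewrite mulN1r.
Qed.

Lemma affineB u v : affine u -> affine v -> affine (fun y => u y - v y).
Proof. by move=> au av; exact/affineD/affineN. Qed.

Lemma rational_affineW u : rational_affine u -> affine u.
Proof. by move=> [a [b uE]]; exists (map_mx ratr a), (ratr b). Qed.

Lemma affine_scale u x (t : R) : affine u ->
  u (t *: x) = t * u x + (1 - t) * u 0.
Proof.
by move=> [a [b uE]]; rewrite !uE pairingZr pairing0r; ring.
Qed.

Lemma affine_continuous u : affine u -> continuous u.
Proof.
move=> [a [b /funext ->]] y.
apply: (@continuousD _ R^o); last exact: cst_continuous.
rewrite /continuous_at /pairing.
apply: (@cvg_big _ _ _ _ _ (@add_continuous R^o) _ (nbhs y)) => i _.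
apply: (@continuousM R 'rV[R]_n (fun=> _)); first exact: cst_continuous.
exact: coord_continuous.
Qed.

Lemma affine_near_gt0 u x : affine u -> 0 < u x -> \forall y \near x, 0 < u y.
Proof.
move=> /affine_continuous uc ux.
exact: (cvgr_gt (F := nbhs x) _ (uc x)).
Qed.

Lemma measurable_affine u (D : set 'rV[R]_n) : affine u -> measurable_fun D u.
Proof.
move=> [a [b /funext ->]]; apply: measurable_funTS.
apply: measurable_funD; last exact: measurable_cst.
apply: measurable_sum => i; apply: measurable_funM; first exact: measurable_cst.
exact: measurable_coord.
Qed.

End affine_functions.

(** * The dual polytope as a bounded polyhedron *)

Section polyhedra.
Variables (R : realType) (n : nat).
Implicit Types (S : seq 'rV[R]_n) (A : set 'rV[R]_n).

Definition polyhedron S : set 'rV[R]_n :=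
  [set y | forall s, s \in S -> 0 <= pairing s y + 1].

(** Finitely many strict inequalities stay true near x. *)
Lemma nbhs_polyhedron S (x : 'rV[R]_n) :
  (forall s, s \in S -> 0 < pairing s x + 1) -> nbhs x (polyhedron S).
Proof.
elim: S => [|s S IH] xS; first by apply: filterS filterT.
have near_s := affine_near_gt0 (affine_halfspace s) (xS s (mem_head _ _)).
have near_S : nbhs x (polyhedron S).
  by apply: IH => r rS; apply: xS; rewrite in_cons rS orbT.
apply: filterS2 near_s near_S => y ys yS r.
by rewrite in_cons => /orP[/eqP ->|/yS//]; exact: ltW.
Qed.

(** Induction principle for convex hulls: the endpoint weights t = 0 and t = 1
    need no check. *)
Lemma hull_sub S A :
    (forall a b (t : R), A a -> A b -> 0 < t < 1 ->
       A (t *: a + (1 - t) *: b)) ->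
    (forall s, s \in S -> A s) ->
  smallest (@convex_set R 'rV[R]_n) [set` S] `<=` A.
Proof.
move=> cA SA; apply: smallest_sub; last by move=> s /=; exact: SA.
apply/convex_setW => a b /set_mem Aa /set_mem Ab t t0 t1.
by apply/mem_set; apply: cA => //; rewrite t0 t1.
Qed.

Lemma halfspace_hull S y (c : R) x :
  smallest (@convex_set R 'rV[R]_n) [set` S] x ->
  (forall s, s \in S -> c <= pairing s y) -> c <= pairing x y.
Proof.
move=> Qx Sy.
apply: (@hull_sub S [set x | c <= pairing x y] _ Sy x Qx) => a b t /= ca cb.
move=> /andP[t0 t1]; rewrite pairing_combl; nra.
Qed.

Lemma seq_lex_min (T : eqType) (F G : T -> R) (s : T) (S : seq T) : s \in S ->
  exists2 q, q \in S &
    forall x, x \in S -> F q < F x \/ (F q = F x /\ G x <= G q).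
Proof.
elim: S s => // a S IH s _; case: S IH => [_|b S IH].
  exists a; rewrite ?mem_head// => x; rewrite inE => /eqP ->.
  by right; split.
have [q qS qmin] := IH b (mem_head _ _).
have [aq|qa] : (F a < F q \/ F a = F q /\ G q <= G a) \/
    (F q < F a \/ F q = F a /\ G a <= G q).
  case: (ltgtP (F a) (F q)) => FF; [by left; left|by right; left|].
  by case: (leP (G q) (G a)) => [GG|/ltW GG]; [left|right]; right.
- exists a; rewrite ?mem_head// => x; rewrite inE => /orP[/eqP ->|xS].
    by right.
  move: (qmin x xS) aq => [] h1 [] h2; [left; lra|left; lra|left; lra|].
  by right; split; lra.
- exists q; first by rewrite in_cons qS orbT.
  by move=> x; rewrite in_cons => /orP[/eqP ->//|]; exact: qmin.
Qed.

(** A linear form on a hull attains its minimum over the generators at a vertex: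
    among the minimising generators, one of maximal Euclidean norm is extreme by
    strict convexity of the norm. Linear inequalities on the hull can thus be
    tested on its vertices. *)
Lemma min_at_vertex S y s : s \in S ->
  exists2 q, vertex (smallest (@convex_set R 'rV[R]_n) [set` S]) q &
    pairing q y <= pairing s y.
Proof.
move=> sS.
have [q qS qmin] :=
  seq_lex_min (fun x => pairing x y) (fun x => pairing x x) sS.
exists q; last by case: (qmin s sS) => [/ltW//|[->]].
set Q := smallest _ _.
(* L contains the generators and is convex: it is the open half-space above
   the minimum, together with a ball of the minimising hyperplane. *)
pose L := [set x | pairing q y < pairing x y \/
  (pairing q y = pairing x y /\ pairing x x <= pairing q q)].
have normE (a b : 'rV[R]_n) (t : R) :
  pairing (t *: a + (1 - t) *: b) (t *: a + (1 - t) *: b) =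
    t * pairing a a + (1 - t) * pairing b b
      - t * (1 - t) * pairing (a - b) (a - b).
  rewrite /pairing !mulr_sumr -!big_split -sumrB; apply: eq_bigr => i _ /=.
  by rewrite !mxE; ring.
have QL : Q `<=` L.
  apply: hull_sub => [a b t|]; last exact: qmin.
  move=> La Lb /andP[t0 t1]; rewrite /L /= pairing_combl normE.
  have := pairing_self_ge0 (a - b) => d0.
  have tt : 0 <= t * (1 - t) * pairing (a - b) (a - b).
    by rewrite !mulr_ge0// ?ltW// subr_gt0.
  case: La Lb => [ha|[ha na]] [hb|[hb nb]]; [left; nra|left; nra|left; nra|].
  by right; split; nra.
split; first by apply: sub_gen_smallest.
move=> a b t /QL La /QL Lb /andP[t0 t1] qE.
(* The form has the same value at q, a and b, as q is a strict convex
   combination of a and b and minimises the form. *)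
have [[ha na] [hb nb]] : (pairing q y = pairing a y /\
    pairing a a <= pairing q q) /\
    (pairing q y = pairing b y /\ pairing b b <= pairing q q).
  have := pairing_combl a b y t; rewrite -qE.
  by case: La Lb => [ha|?] [hb|?] // h; exfalso; nra.
have ab : a = b.
  apply/eqP; rewrite -subr_eq0; apply/eqP/pairing_self_eq0.
  have := normE a b t; rewrite -qE => h.
  have tt : 0 < t * (1 - t) by rewrite mulr_gt0// subr_gt0.
  by nra.
by move: qE; rewrite ab -scalerDl addrC subrK scale1r.
Qed.

(** The finitely many generators cut out the same set as the vertices, which
    makes measurability and openness arguments finite. *)
Lemma dual_polytopeE S :
  dual_polytope (smallest (@convex_set R 'rV[R]_n) [set` S]) = polyhedron S.
Proof.
apply/seteqP; split=> y Py.
  move=> s sS; have [q vq qs] := min_at_vertex y sS.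
  by have := Py q vq; lra.
move=> q [Qq _]; suff : -1 <= pairing q y by lra.
by apply: halfspace_hull Qq _ => s /Py; lra.
Qed.

(** If the hull contains the cube of radius r around 0, testing a point of the
    polyhedron against multiples of the basis vectors of that cube bounds each of
    its coordinates. *)
Lemma polyhedron_bounded S :
  interior (smallest (@convex_set R 'rV[R]_n) [set` S]) 0 ->
  exists K, forall y, polyhedron S y -> forall i, `|y ord0 i| <= K.
Proof.
move=> /nbhs_ballP[r /= r0 rQ]; exists (2 / r) => y Py i.
have bnd (c : R) : `|c| < r -> -1 <= c * y ord0 i.
  move=> cr; have -> : c * y ord0 i = pairing (c *: delta_mx ord0 i) y.
    have [a [b coordE]] := affine_coord R i.
    rewrite pairingC pairingZr pairingC; congr (_ * _).
    rewrite /pairing (bigD1 i)//= big1 ?mxE ?eqxx ?mul1r ?addr0// => j.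
    by move=> /negPf ji; rewrite mxE ji andbF mul0r.
  apply: (@halfspace_hull S) => [|s /Py]; last by lra.
  apply: rQ; split=> // k j; rewrite -ball_normE /= !mxE sub0r normrN normrM.
  rewrite (le_lt_trans _ cr)// ler_piMr//.
  by case: andP; rewrite ?normr1 ?normr0.
(* The cube is open, so r / 2 is used in place of r. *)
have r2 : `|r / 2| < r by rewrite ger0_norm; lra.
have := bnd (r / 2) r2; have := bnd (- (r / 2)); rewrite normrN => /(_ r2).
move=> h1 h2; rewrite ler_norml lerNl; apply/andP; split.
all: rewrite ler_pdivlMr//; lra.
Qed.

End polyhedra.

(** * Integration over a bounded polyhedron *)

Section boxes.
Variables (R : realType) (n : nat).

Definition box (A : 'I_n -> set R) : set 'rV[R]_n :=
  [set v | forall i, A i (v ord0 i)].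

Lemma measurable_box (A : 'I_n -> set R) :
  (forall i, measurable (A i)) -> measurable (box A).
Proof.
move=> mA; have -> : box A = \bigcap_(i in [set: 'I_n])
    ((fun v : 'rV[R]_n => v ord0 i) @^-1` A i).
  by apply/seteqP; split=> [v Av i _|v Av i]; exact: Av.
apply: fin_bigcap_measurable => [|i _]; first exact: finite_finset.
by rewrite -[X in measurable X]setTI; exact: measurable_coord.
Qed.

Lemma lebesgue_box_lty (a b : 'I_n -> R) :
  (lebesgue_rV R n (box (fun i => `[a i, b i]%classic)) < +oo)%E.
Proof.
rewrite lebesgue_rV_box//.
rewrite ltey_eq prode_fin_num// => i _; rewrite lebesgue_measure_itv.
by case: ifP.
Qed.

Lemma nbhs_box (x : 'rV[R]_n) (A : set 'rV[R]_n) : nbhs x A ->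
  exists B, [/\ measurable B, B `<=` A & (0 < lebesgue_rV R n B)%E].
Proof.
move=> /nbhs_ballP[r /= r0 rA].
pose I i := `]x ord0 i - r, x ord0 i + r[%classic.
exists (box I); split.
- by apply: measurable_box => i; exact: measurable_itv.
- move=> v Iv; apply: rA; split=> // k i; rewrite ord1.
  rewrite -ball_normE /= ltr_distl.
  have := Iv i; rewrite /I /= in_itv /= => /andP[? ?].
  by apply/andP; split; lra.
rewrite lebesgue_rV_box; last by move=> i; exact: measurable_itv.
elim/big_ind : _ => // [a b a0 b0|i _]; first by rewrite mule_gt0.
rewrite lebesgue_measure_itv /= lte_fin ifT; last by lra.
by rewrite -EFinB lte_fin; lra.
Qed.

End boxes.

Section integration.
Variables (R : realType) (n : nat) (S : seq 'rV[R]_n).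
Let P := polyhedron S.
Let mu := lebesgue_rV R n.
Hypothesis P_bounded : exists K, forall y, P y -> forall i, `|y ord0 i| <= K.
Implicit Types (f g u v w : 'rV[R]_n -> R).

(** A class of functions integrable on P that is closed under the products and
    maxima formed below, which integrability alone is not. *)
Definition bounded_measurable (D : set 'rV[R]_n) f :=
  measurable_fun D f /\ exists K, forall y, D y -> `|f y| <= K.

Lemma measurable_polyhedron : measurable P.
Proof.
have -> : P = \bigcap_(s in [set` S])
    ((fun y => pairing s y + 1) @^-1` `[0, +oo[%classic).
  apply/seteqP; split=> y Py s sS /=; first by rewrite in_itv /= andbT Py.
  by have := Py s sS; rewrite /= in_itv /= andbT.
apply: fin_bigcap_measurable => [|s _]; first exact: finite_seq.
rewrite -[X in measurable X]setTI.
by apply: measurable_affine => //; exact: affine_halfspace.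
Qed.
Let mP := measurable_polyhedron.

Lemma polyhedron0 : P 0.
Proof. by move=> s _; rewrite pairing0r add0r. Qed.

Lemma volume_lty : (mu P < +oo)%E.
Proof.
have [K PK] := P_bounded.
apply: le_lt_trans (lebesgue_box_lty (fun _ => - K) (fun _ => K)).
apply: le_measure; rewrite ?inE//; first by apply: measurable_box.
by move=> y Py i; rewrite /= in_itv /= -ler_norml; exact: PK.
Qed.

Lemma bounded_measurable_affine u : affine u -> bounded_measurable P u.
Proof.
move=> au; split; first exact: measurable_affine.
have [K PK] := P_bounded; have [a [b uE]] := au.
exists (\sum_(i < n) `|a ord0 i| * K + `|b|) => y Py.
rewrite uE (le_trans (ler_normD _ _))// lerD2r.
rewrite (le_trans (ler_norm_sum _ _ _))//; apply: ler_sum => i _.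
by rewrite normrM ler_wpM2l// PK.
Qed.

Lemma bounded_measurableD f g : bounded_measurable P f ->
  bounded_measurable P g -> bounded_measurable P (fun y => f y + g y).
Proof.
move=> [mf [K fK]] [mg [L gL]]; split; first exact: measurable_funD.
exists (K + L) => y Py.
by rewrite (le_trans (ler_normD _ _))// lerD ?fK ?gL.
Qed.

Lemma bounded_measurableM f g : bounded_measurable P f ->
  bounded_measurable P g -> bounded_measurable P (fun y => f y * g y).
Proof.
move=> [mf [K fK]] [mg [L gL]]; split; first exact: measurable_funM.
by exists (K * L) => y Py; rewrite normrM ler_pM ?fK ?gL.
Qed.

Lemma bounded_measurableB f g : bounded_measurable P f ->
  bounded_measurable P g -> bounded_measurable P (fun y => f y - g y).
Proof.
move=> bf [mg [L gL]]; apply: bounded_measurableD => //; split.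
  exact: measurable_funN.
by exists L => y Py; rewrite normrN gL.
Qed.

Lemma bounded_measurable_max f g : bounded_measurable P f ->
  bounded_measurable P g -> bounded_measurable P (fun y => Num.max (f y) (g y)).
Proof.
move=> [mf [K fK]] [mg [L gL]]; split; first exact: measurable_maxr.
exists (Num.max K L) => y Py; rewrite le_max.
by case: (leP (f y) (g y)) => _; rewrite ?fK ?gL ?orbT.
Qed.

Lemma bounded_measurable_eq f g : {in P, f =1 g} ->
  bounded_measurable P f -> bounded_measurable P g.
Proof.
move=> fg [mf [K fK]]; split; first exact: eq_measurable_fun fg mf.
by exists K => y Py; rewrite -fg ?inE// fK.
Qed.

Lemma bounded_measurable_bigmax k (l : 'I_k.+1 -> 'rV[R]_n -> R) :
  (forall i, affine (l i)) ->
  bounded_measurable P (fun y => \big[Num.max/l ord0 y]_(i < k.+1) l i y).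
Proof.
move=> al; elim: (index_enum _) => [|i s IH].
  apply: bounded_measurable_eq (bounded_measurable_affine (al ord0)) => y _.
  by rewrite big_nil.
apply: bounded_measurable_eq
  (bounded_measurable_max (bounded_measurable_affine (al i)) IH) => y _.
by rewrite big_cons.
Qed.

Lemma bounded_measurable_PL f : rational_PL_convex P f ->
  bounded_measurable P f.
Proof.
move=> [k [l [al fE]]]; apply: bounded_measurable_eq
  (bounded_measurable_bigmax (fun i => rational_affineW (al i))) => y.
by rewrite inE => /fE.
Qed.

Lemma bounded_measurable_integrable f : bounded_measurable P f ->
  mu.-integrable P (EFin \o f).
Proof.
move=> [mf [K fK]]; apply: measurable_bounded_integrable => //.
  exact: volume_lty.
exists K; split; first exact: num_real.
by move=> M KM y Py; rewrite /= (le_trans (fK y Py))// ltW.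
Qed.
Let integr := bounded_measurable_integrable.

(** A nonnegative function with zero integral vanishes almost everywhere, whereas
    every neighbourhood contains a box of positive measure. *)
Lemma Rintegral_gt0 f (x : 'rV[R]_n) : bounded_measurable P f ->
  (forall y, P y -> 0 <= f y) ->
  (\forall y \near x, P y /\ 0 < f y) -> 0 < \int[mu]_(y in P) f y.
Proof.
move=> bf f0 fx; rewrite lt_neqAle Rintegral_ge0// andbT eq_sym.
apply/eqP => If0.
have [B [mB BA B0]] := nbhs_box fx.
have mf : measurable_fun P (EFin \o f) by apply/measurable_EFinP; case: bf.
have : (\int[mu]_(y in P) `|(EFin \o f) y| = 0)%E.
  have <- : (\int[mu]_(y in P) (f y)%:E = 0)%E.
    by rewrite -[LHS]fineK ?(integrable_fin_num mP (integr bf))//; congr EFin.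
  by apply: eq_integral => y /set_mem Py; rewrite /= ger0_norm// f0.
move=> /(ae_eq_integral_abs mu mP mf)[N [mN muN fN]].
suff : (mu B <= mu N)%E by rewrite muN leNgt B0.
apply: le_measure; rewrite ?inE// => y /BA[Py fy].
apply: fN => /= /(_ Py)[fy0]; by rewrite fy0 ltxx in fy.
Qed.

Lemma volume_gt0 : 0 < fine (mu P).
Proof.
rewrite -[X in 0 < X]mul1r -Rintegral_cst//.
apply: (@Rintegral_gt0 _ 0) => //.
  exact/bounded_measurable_affine/affine_cst.
have : nbhs (0 : 'rV[R]_n) P.
  by apply: nbhs_polyhedron => s _; rewrite pairing0r add0r.
by apply: filterS => y Py; split.
Qed.

(** Moving p slightly towards 0 leads into the interior of P, preserves the strict
    inequality u > 0 if the step is small, and makes w positive since w is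
    nonnegative at p and positive at 0. *)
Lemma interior_approx p u w : P p -> affine u -> affine w ->
    0 < u p -> 0 <= w p -> 0 < w 0 ->
  exists x : 'rV[R]_n, \forall y \near x, [/\ P y, 0 < u y & 0 < w y].
Proof.
move=> Pp au aw up wp w0.
(* The step e must satisfy e * `|u 0| < (1 - e) * u p; the summand 1 in the
   denominator keeps e below 1 when u 0 = 0. *)
have e0 : 0 < u p / (`|u 0| + u p + 1) < 1.
  have d0 : 0 < `|u 0| + u p + 1 by rewrite ltr_pwDr// addr_ge0// ltW.
  by rewrite divr_gt0//= ltr_pdivrMr// mul1r; have := normr_ge0 (u 0); lra.
have eu : u p / (`|u 0| + u p + 1) * (`|u 0| + u p) < u p.
  have d0 : 0 < `|u 0| + u p + 1 by rewrite ltr_pwDr// addr_ge0// ltW.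
  rewrite mulrAC ltr_pdivrMr// ltr_pM2l//; lra.
move: (u p / _) e0 eu => e /andP[e0 e1] eu.
exists ((1 - e) *: p).
have xE v : affine v -> v ((1 - e) *: p) = (1 - e) * v p + e * v 0.
  by move=> av; rewrite affine_scale// subKr.
have near_P : nbhs ((1 - e) *: p) P.
  apply: nbhs_polyhedron => s /Pp; rewrite pairingZr; nra.
have near_u : \forall y \near (1 - e) *: p, 0 < u y.
  apply: affine_near_gt0 => //; rewrite xE//.
  have : - `|u 0| <= u 0 by rewrite lerNl ler_normr lexx orbT.
  nra.
have near_w : \forall y \near (1 - e) *: p, 0 < w y.
  by apply: affine_near_gt0 => //; rewrite xE//; nra.
by apply: filterS3 near_P near_u near_w => y.
Qed.

Lemma rational_affine_approx u e : affine u -> 0 < e ->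
  exists2 h, rational_affine h & forall y, P y -> `|h y - u y| <= e.
Proof.
move=> [a [b uE]] e0; have [K PK] := P_bounded.
(* The n linear coefficients and the constant one are each approximated up to
   d; the total error on P is at most d * (n * K + 1). *)
pose d := e / (n%:R * `|K| + 1).
have D0 : 0 < n%:R * `|K| + 1 by rewrite ltr_pwDr// mulr_ge0.
have d0 : 0 < d by rewrite divr_gt0.
have rat_approx (x : R) : exists q : rat, `|ratr q - x| <= d.
  have [|q] := @rat_in_itvoo R (x - d) (x + d); first by lra.
  rewrite in_itv /= => /andP[? ?]; exists q.
  by rewrite ler_distl; apply/andP; split; lra.
have [q bq] := rat_approx b.
have /choice[c ac] : forall i, exists q : rat, `|ratr q - a ord0 i| <= d.
  by move=> i; exact: rat_approx.
exists (fun y => pairing (map_mx ratr (\row_i c i)) y + ratr q) => [|y Py].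
  by exists (\row_i c i), q.
rewrite uE opprD addrACA (le_trans (ler_normD _ _))//.
have : `|pairing (map_mx ratr (\row_i c i)) y - pairing a y| <=
    d * (n%:R * `|K|).
  rewrite /pairing -sumrB (le_trans (ler_norm_sum _ _ _))//.
  rewrite (le_trans (_ : _ <= \sum_(i < n) d * `|K|))//.
    apply: ler_sum => i _; rewrite !mxE -mulrBl normrM ler_pM//.
    by rewrite (le_trans (PK y Py i))// ler_norm.
  by rewrite sumr_const card_ord -[leLHS]mulr_natl mulrCA.
have : d * (n%:R * `|K| + 1) = e by rewrite /d divfK// gt_eqF.
lra.
Qed.

End integration.

(** * Stability *)

Section stability.
Variables (R : realType) (n : nat) (S : seq 'rV[R]_n).
Let P := polyhedron S.
Let mu := lebesgue_rV R n.
Let V := fine (mu P).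
Hypothesis P_bounded : exists K, forall y, P y -> forall i, `|y ord0 i| <= K.
Implicit Types (f g u v w l : 'rV[R]_n -> R).

Let mP : measurable P := measurable_polyhedron S.
Let V0 : 0 < V := volume_gt0 P_bounded.
Let P0 : P 0 := @polyhedron0 R n S.
Let integr f : bounded_measurable P f -> mu.-integrable P (EFin \o f) :=
  bounded_measurable_integrable P_bounded (f := f).
Let bma u : affine u -> bounded_measurable P u :=
  bounded_measurable_affine P_bounded (u := u).

Lemma bounded_measurable_inf_le g y : bounded_measurable P g -> P y ->
  inf [set g z | z in P] <= g y.
Proof.
move=> [_ [K gK]] Py; apply: ge_inf; last by exists y.
exists (- K) => _ [z Pz <-].
by rewrite lerNl (le_trans _ (gK z Pz))// ler_normr lexx orbT.
Qed.

Lemma inf_le_average g : bounded_measurable P g ->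
  0 <= V^-1 * (\int[mu]_(y in P) g y) - inf [set g y | y in P].
Proof.
move=> bg; rewrite subr_ge0 -ler_pdivrMl ?invr_gt0// invrK mulrC.
rewrite -Rintegral_cst//; apply: le_Rintegral => //; try exact: integr.
  exact/integr/bma/affine_cst.
by move=> y Py; exact: bounded_measurable_inf_le.
Qed.

Lemma J_T_ge0 f : bounded_measurable P f -> 0 <= J_T P f.
Proof.
move=> bf; apply: lb_le_inf.
  by eexists; exists (fun=> 0) => //; exact: affine_cst.
move=> _ [l al <-]; apply: inf_le_average.
exact: bounded_measurableB bf (bma al).
Qed.

(** The support function l is one of the competitors in J_T, and the infimum of
    f - l is 0, attained at the origin. *)
Lemma J_T_le_support f l : bounded_measurable P f -> affine l ->
    (forall y, P y -> l y <= f y) -> l 0 = f 0 ->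
  J_T P f <= V^-1 * \int[mu]_(y in P) (f y - l y).
Proof.
move=> bf al lf l0.
have inf0 : 0 <= inf [set f y - l y | y in P].
  apply: lb_le_inf; first by exists (f 0 - l 0), 0.
  by move=> _ [y Py <-]; rewrite subr_ge0 lf.
apply: le_trans (_ : V^-1 * (\int[mu]_(y in P) (f y - l y))
  - inf [set f y - l y | y in P] <= _); last by rewrite lerBlDr lerDl.
apply: ge_inf; last by exists l.
exists 0 => _ [k ak <-]; apply: inf_le_average.
exact: bounded_measurableB bf (bma ak).
Qed.

Lemma Rintegral_sum (I : Type) (s : seq I) (F : I -> 'rV[R]_n -> R) :
    (forall i, bounded_measurable P (F i)) ->
  bounded_measurable P (fun y => \sum_(i <- s) F i y) /\
  \int[mu]_(y in P) (\sum_(i <- s) F i y) =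
    \sum_(i <- s) \int[mu]_(y in P) F i y.
Proof.
move=> bF; elim: s => [|i s [bs IH]].
  have e : (fun y : 'rV[R]_n => \sum_(i <- [::]) F i y) = fun=> 0.
    by apply/funext => y; rewrite big_nil.
  rewrite e; split; first exact/bma/affine_cst.
  by rewrite Rintegral_cst// mul0r big_nil.
have e : (fun y => \sum_(j <- i :: s) F j y) =
    fun y => F i y + \sum_(j <- s) F j y.
  by apply/funext => y; rewrite big_cons.
rewrite e; split; first exact: bounded_measurableD.
by rewrite RintegralD ?IH ?big_cons//; exact: integr.
Qed.

Definition barycenter : 'rV[R]_n :=
  \row_i (V^-1 * \int[mu]_(y in P) (y ord0 i)).

Lemma affine_barycenter u : affine u ->
  u barycenter = V^-1 * \int[mu]_(y in P) u y.
Proof.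
move=> [a [b uE]].
have bc i : bounded_measurable P (fun y => a ord0 i * y ord0 i).
  by apply/bma/affineZ/affine_coord.
have [bs Is] := Rintegral_sum (index_enum 'I_n) bc.
have -> : u = fun y => pairing a y + b by apply/funext.
rewrite RintegralD//; [|exact: integr|exact/integr/bma/affine_cst].
rewrite Rintegral_cst// mulrDr [V^-1 * (b * _)]mulrCA mulVf ?gt_eqF// mulr1.
congr (_ + _); rewrite /pairing Is mulr_sumr; apply: eq_bigr => i _.
by rewrite mxE (RintegralZl _ mP (integr (bma (affine_coord R i)))) mulrCA.
Qed.

Lemma barycenter_in : P barycenter.
Proof.
move=> s sS; rewrite (affine_barycenter (affine_halfspace s)).
rewrite mulr_ge0 ?invr_ge0 ?(ltW V0)//.
by apply: Rintegral_ge0 => y Py; exact: Py.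
Qed.

(** Bounding the infimum of f - l by its value at the barycenter cancels the
    average of l, whatever the affine function l. *)
Lemma J_T_ge_average f : bounded_measurable P f -> f barycenter = 0 ->
  V^-1 * (\int[mu]_(y in P) f y) <= J_T P f.
Proof.
move=> bf fb; apply: lb_le_inf.
  by eexists; exists (fun=> 0) => //; exact: affine_cst.
move=> _ [l al <-].
rewrite RintegralB//; [|exact: integr|exact/integr/bma].
have bfl := bounded_measurableB bf (bma al).
have := bounded_measurable_inf_le bfl barycenter_in.
by rewrite mulrBr -(affine_barycenter al) fb; lra.
Qed.

(** One of the affine pieces that is maximal at p supports f there. *)
Lemma PL_support f p : rational_PL_convex P f -> P p ->
  exists l, [/\ affine l, l p = f p & forall y, P y -> l y <= f y].
Proof.
move=> [k [l [al fE]]] Pp.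
have [i ip] : exists i, l i p = f p.
  rewrite fE//; elim/big_ind : _ => [|a b [i <-] [j <-]|i _].
  - by exists ord0.
  - by case: leP; [exists j|exists i].
  - by exists i.
exists (l i); split => // [|y Py]; first exact: rational_affineW.
by rewrite fE// (le_bigmax _ (fun i => l i y)).
Qed.

Lemma rational_PL_pos h : rational_affine h ->
  rational_PL_convex P (fun y => Num.max 0 (h y)).
Proof.
move=> rh; exists 1%N, (fun i => if i == ord0 then fun=> 0 else h); split.
  move=> i; case: ifP => _ //; exists 0, 0 => y.
  by rewrite rmorph0 addr0 /pairing big1// => j _; rewrite !mxE rmorph0 mul0r.
move=> y _; rewrite !big_ord_recl big_ord0 /=.
by rewrite [Num.max (h y) 0]maxC maxA maxxx.
Qed.

Variable ell : 'rV[R]_n -> R.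
Hypothesis ricci_ell : ricci_affine P ell.

Let ell_affine : affine ell := ricci_ell.1.
Let bell : bounded_measurable P ell := bma ell_affine.

Lemma integral_ricci : \int[mu]_(y in P) ell y = 1.
Proof.
have := ricci_ell.2 _ (affine_cst n (1 : R)).
rewrite /D_NA; under eq_Rintegral do rewrite mul1r.
by move/eqP; rewrite addrC subr_eq0 => /eqP.
Qed.

(** D_NA is additive and vanishes on l, and the Dirac terms of f and l cancel. *)
Lemma D_NA_support f l : bounded_measurable P f -> affine l -> l 0 = f 0 ->
  D_NA P ell f = \int[mu]_(y in P) ((f y - l y) * ell y).
Proof.
move=> bf al l0; have := ricci_ell.2 _ al; rewrite /D_NA.
have -> : \int[mu]_(y in P) ((f y - l y) * ell y) =
    \int[mu]_(y in P) (f y * ell y - l y * ell y).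
  by apply: eq_Rintegral => y _; rewrite mulrBl.
rewrite RintegralB//; [lra|apply: integr..].
- exact: bounded_measurableM.
- exact: bounded_measurableM (bma al) bell.
Qed.

(** Testing the Ricci property on ell itself gives ell 0 = int ell^2, which is
    at least 1 / V by Cauchy-Schwarz, since int ell = 1. *)
Lemma ricci0_gt0 : 0 < ell 0.
Proof.
have ell2 : \int[mu]_(y in P) (ell y * ell y) = ell 0.
  by have := ricci_ell.2 _ ell_affine; rewrite /D_NA; lra.
apply: lt_le_trans (_ : V^-1 <= _); first by rewrite invr_gt0.
(* Cauchy-Schwarz, in the form that (ell - 1 / V)^2 has nonnegative integral. *)
have : 0 <= \int[mu]_(y in P) (ell y * ell y - (2 * V^-1 * ell y - V^-1 ^+ 2)).
  by apply: Rintegral_ge0 => y _; have := sqr_ge0 (ell y - V^-1); nra.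
have be2 := bounded_measurableM bell bell.
have al : affine (fun y => 2 * V^-1 * ell y - V^-1 ^+ 2).
  by apply: affineB; [exact: affineZ|exact: affine_cst].
rewrite RintegralB//; [|exact: integr|exact/integr/bma].
rewrite RintegralB//; [|exact/integr/bma/affineZ|exact/integr/bma/affine_cst].
rewrite RintegralZl ?integral_ricci//; last exact: integr.
have -> : \int[mu]_(y in P) (V^-1 ^+ 2) = V^-1.
  by rewrite Rintegral_cst// expr2 -mulrA mulVf ?mulr1// gt_eqF.
rewrite ell2; lra.
Qed.

Section nonnegative.
Hypothesis ell_ge0 : forall y, P y -> 0 <= ell y.

Lemma D_NA_ge0 f : rational_PL_convex P f -> 0 <= D_NA P ell f.
Proof.
move=> PLf; have [l [al l0 lf]] := PL_support PLf P0.
rewrite (D_NA_support (bounded_measurable_PL P_bounded PLf) al l0).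
by apply: Rintegral_ge0 => y Py; rewrite mulr_ge0 ?subr_ge0 ?lf ?ell_ge0.
Qed.

(** Away from a support function l of f at 0, the integrand (f - l) * ell is
    bounded below near p by the product of two positive affine functions. *)
Lemma D_NA_eq0_affine f : rational_PL_convex P f ->
  D_NA P ell f = 0 -> affine_on P f.
Proof.
move=> PLf; have [l [al l0 lf]] := PL_support PLf P0.
have bf := bounded_measurable_PL P_bounded PLf.
rewrite (D_NA_support bf al l0) => D0.
exists l => // p Pp; apply/le_anti; rewrite lf// andbT leNgt.
apply/negP => lp; have [k [ak kp kf]] := PL_support PLf Pp.
have kl : 0 < k p - l p by rewrite kp subr_gt0.
have [x near_x] :=
  interior_approx Pp (affineB ak al) ell_affine kl (ell_ge0 Pp) ricci0_gt0.
have : 0 < \int[mu]_(y in P) ((f y - l y) * ell y).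
  apply: (@Rintegral_gt0 _ _ _ P_bounded _ x).
  - exact: bounded_measurableM (bounded_measurableB bf (bma al)) bell.
  - by move=> y Py; rewrite mulr_ge0 ?subr_ge0 ?lf ?ell_ge0.
  - apply: filterS near_x => y [Py kly ly]; split => //.
    by rewrite mulr_gt0// (lt_le_trans kly)// lerD2r kf.
by rewrite D0 ltxx.
Qed.

End nonnegative.

Lemma uniform_D_NA_ge c f : 0 < c -> (forall y, P y -> c <= ell y) ->
  rational_PL_convex P f -> c * V * J_T P f <= D_NA P ell f.
Proof.
move=> c0 cl PLf; have [l [al l0 lf]] := PL_support PLf P0.
have bf := bounded_measurable_PL P_bounded PLf.
have bfl := bounded_measurableB bf (bma al).
rewrite (D_NA_support bf al l0) -mulrA.
apply: le_trans (_ : c * \int[mu]_(y in P) (f y - l y) <= _).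
  rewrite ler_pM2l// -ler_pdivlMl//.
  exact: J_T_le_support.
rewrite -RintegralZl//; last exact: integr.
apply: le_Rintegral => // [||y Py].
- exact/integr/(bounded_measurableM (bma (affine_cst n c))).
- exact/integr/bounded_measurableM.
- by rewrite mulrC ler_wpM2l ?subr_ge0 ?lf ?cl.
Qed.

(** For g = max(0, - ell) one has g * ell = - g^2, with strictly negative integral.
    Replacing - ell by a rational h within e of it on P changes the integral by
    at most e * K * V, with K a bound of |ell| on P. *)
Lemma exists_destabilizing p : P p -> ell p < 0 ->
  exists2 f, rational_PL_convex P f & D_NA P ell f < 0.
Proof.
move=> Pp ellp; pose g y := Num.max 0 (- ell y).
have bg : bounded_measurable P g.
  by apply: bounded_measurable_max; [exact/bma/affine_cst|exact/bma/affineN].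
have bg2 := bounded_measurableM bg bg.
have Ig : 0 < \int[mu]_(y in P) (g y * g y).
  have nellp : 0 < - ell p by rewrite oppr_gt0.
  have [x near_x] := interior_approx Pp (affineN ell_affine)
    (affine_cst n (1 : R)) nellp ler01 ltr01.
  apply: (@Rintegral_gt0 _ _ _ P_bounded _ x) => // [y _|].
    by rewrite -expr2 sqr_ge0.
  apply: filterS near_x => y [Py ely _]; split => //.
  by rewrite mulr_gt0// lt_max ely orbT.
have [_ [K ellK]] := bell.
(* The choice of e below makes e * c half of the integral of g^2. *)
pose c := 1 + `|K| * V.
have c0 : 0 < c by rewrite ltr_pwDl// mulr_ge0// ltW.
pose e := (\int[mu]_(y in P) (g y * g y)) / (2 * c).
have e0 : 0 < e by rewrite divr_gt0// mulr_gt0.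
have [h rh hE] := rational_affine_approx P_bounded (affineN ell_affine) e0.
exists (fun y => Num.max 0 (h y)); first exact: rational_PL_pos.
have close y : P y -> `|Num.max 0 (h y) - g y| <= e.
  move=> /hE; rewrite /g !ler_distl.
  by case: (leP 0 (h y)); case: (leP 0 (- ell y)); lra.
have bh := bounded_measurable_PL P_bounded (rational_PL_pos rh).
have : \int[mu]_(y in P) (Num.max 0 (h y) * ell y) <=
    \int[mu]_(y in P) (e * `|K| - g y * g y).
  apply: le_Rintegral => // [||y Py].
  - exact/integr/bounded_measurableM.
  - by apply/integr/bounded_measurableB => //; exact/bma/affine_cst.
  have gl : g y * g y = - (g y * ell y).
    by rewrite /g; case: leP => _; ring.
  rewrite gl opprK -lerBlDr -mulrBl (le_trans (ler_norm _))// normrM.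
  by rewrite ler_pM ?close// (le_trans (ellK y Py))// ler_norm.
rewrite RintegralB//; [|exact/integr/bma/affine_cst|exact: integr].
rewrite Rintegral_cst// -/V /D_NA.
have : 0 <= Num.max 0 (h 0) by rewrite le_max lexx.
have : e * (2 * c) = \int[mu]_(y in P) (g y * g y).
  by rewrite /e divfK// gt_eqF// mulr_gt0.
have : e * c = e + e * `|K| * V by rewrite /c mulrDr mulr1 mulrA.
lra.
Qed.

(** With h within e of 2 e - ell, the function max(0, h) is supported in
    ell <= 3 e, hence vanishes at the barycenter, and is positive where ell < e.
    So D_NA is smaller than J_T by a factor of order e. *)
Lemma exists_small_D_NA e : 0 < e -> (forall y, P y -> 0 <= ell y) ->
    (exists2 p, P p & ell p < e) -> 3 * e <= ell barycenter ->
  exists f, [/\ rational_PL_convex P f, 0 < V^-1 * \int[mu]_(y in P) f y,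
    V^-1 * \int[mu]_(y in P) f y <= J_T P f &
    D_NA P ell f <= 3 * e * \int[mu]_(y in P) f y].
Proof.
move=> e0 ell_ge0 [p Pp pe] be.
have a2 : affine (fun y => 2 * e - ell y).
  by apply: affineB => //; exact: affine_cst.
have [h rh hE] := rational_affine_approx P_bounded a2 e0.
have PLf := rational_PL_pos rh; have bf := bounded_measurable_PL P_bounded PLf.
have If : 0 < \int[mu]_(y in P) Num.max 0 (h y).
  have hp : 0 < h p by have := hE p Pp; rewrite ler_distl; lra.
  have [x near_x] := interior_approx Pp (rational_affineW rh)
    (affine_cst n (1 : R)) hp ler01 ltr01.
  apply: (@Rintegral_gt0 _ _ _ P_bounded _ x) => // [y _|].
    by rewrite le_max lexx.
  by apply: filterS near_x => y [Py hy _]; rewrite lt_max hy orbT.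
exists (fun y => Num.max 0 (h y)); split => //.
- by rewrite mulr_gt0// invr_gt0.
- apply: J_T_ge_average => //; apply/max_idPl.
  have := hE _ barycenter_in; rewrite ler_distl; lra.
rewrite /D_NA; have f0 : 0 <= Num.max 0 (h 0) by rewrite le_max lexx.
suff : \int[mu]_(y in P) (Num.max 0 (h y) * ell y) <=
    3 * e * \int[mu]_(y in P) Num.max 0 (h y) by lra.
rewrite -RintegralZl//; last exact: integr.
apply: le_Rintegral => // [||y Py].
- exact/integr/bounded_measurableM.
- exact/integr/(bounded_measurableM (bma (affine_cst n (3 * e)))).
rewrite mulrC; case: (leP 0 (h y)) => hy; last by rewrite !mulr0.
rewrite ler_wpM2r//; have := hE y Py; rewrite ler_distl; lra.
Qed.

Let m := inf [set ell y | y in P].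

Let inf_ge0 : 0 <= m -> forall y, P y -> 0 <= ell y.
Proof. by move=> m0 y Py; rewrite (le_trans m0)// bounded_measurable_inf_le. Qed.

Let unstable_of_inf_lt0 : m < 0 -> relatively_D_unstable P ell.
Proof.
move=> /inf_lt[|_ [p Pp <-] ellp]; first by exists (ell 0), 0.
exact: exists_destabilizing Pp ellp.
Qed.

Lemma relatively_D_stableP : relatively_D_stable P ell <-> 0 <= m.
Proof.
split=> [st|/inf_ge0 ell_ge0 f PLf].
  rewrite leNgt; apply/negP => /unstable_of_inf_lt0[f /st[f0 _]].
  by rewrite ltNge f0.
by split; [exact: D_NA_ge0|exact: D_NA_eq0_affine].
Qed.

Lemma relatively_D_unstableP : relatively_D_unstable P ell <-> m < 0.
Proof.
split=> // -[f PLf Df]; rewrite ltNge; apply/negP => /inf_ge0 ell_ge0.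
by move: Df; rewrite ltNge D_NA_ge0.
Qed.

Lemma uniformly_relative_D_stableP : uniformly_relative_D_stable P ell <-> 0 < m.
Proof.
split=> [[d d0 un]|m0]; last first.
  exists (m * V) => [|f PLf]; first exact: mulr_gt0.
  apply: uniform_D_NA_ge => // y Py; exact: bounded_measurable_inf_le.
case: (ltgtP 0 m) => // [/unstable_of_inf_lt0[f PLf]|m0].
  rewrite ltNge => /negP[]; apply: le_trans (un f PLf).
  rewrite mulr_ge0 ?(ltW d0)//.
  exact/J_T_ge0/(bounded_measurable_PL P_bounded).
have V1 : 0 < V^-1 by rewrite invr_gt0.
have bE : ell barycenter = V^-1.
  by rewrite affine_barycenter// integral_ricci mulr1.
(* 3 e <= 1 / V makes the test function vanish at the barycenter, and
   3 e < d / V contradicts the uniform bound with constant d. *)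
pose e := Num.min V^-1 (d * V^-1 / 2) / 3.
have mV : 0 < Num.min V^-1 (d * V^-1 / 2).
  by rewrite lt_min V1 !divr_gt0// mulr_gt0.
have e0 : 0 < e by rewrite divr_gt0.
have e3 : 3 * e = Num.min V^-1 (d * V^-1 / 2) by rewrite /e mulrC divfK.
have [|||f [PLf f0 fJ fD]] := @exists_small_D_NA e e0.
- by apply: inf_ge0; rewrite -m0.
- have /inf_lt[|_ [p Pp <-] ellp] : m < e by rewrite -m0.
    by exists (ell 0), 0.
  by exists p.
- by rewrite e3 bE ge_min lexx.
have := un f PLf; move: fD; rewrite e3.
set I := Rintegral _ _ _ in f0 fJ *.
have I0 : 0 < I by move: f0; rewrite pmulr_rgt0.
have : Num.min V^-1 (d * V^-1 / 2) <= d * V^-1 / 2 by rewrite ge_min lexx orbT.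
move=> h1 h2 h3.
have h4 : Num.min V^-1 (d * V^-1 / 2) * I <= d * V^-1 / 2 * I.
  by rewrite ler_wpM2r// ltW.
have h5 : d * (V^-1 * I) <= d * J_T P f by rewrite ler_pM2l.
have h6 : 0 < d * (V^-1 * I) by rewrite mulr_gt0.
lra.
Qed.

Lemma non_uniformly_relative_D_stableP :
  non_uniformly_relative_D_stable P ell <-> m = 0.
Proof.
rewrite /non_uniformly_relative_D_stable relatively_D_stableP.
rewrite uniformly_relative_D_stableP; split.
  by move=> [m0 /negP]; rewrite -leNgt => m1; apply/le_anti; rewrite m0 m1.
by move=> ->; rewrite lexx ltxx.
Qed.

End stability.

Theorem corollary33 (R : realType) (n : nat) (Q P : set 'rV[R]_n)
    (ell : 'rV[R]_n -> R) :
  fano_polytope Q -> P = dual_polytope Q -> ricci_affine P ell ->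
  [/\ (relatively_D_stable P ell <-> 0 <= inf [set ell y | y in P]),
      (uniformly_relative_D_stable P ell <-> 0 < inf [set ell y | y in P]) /\
      (non_uniformly_relative_D_stable P ell <->
         inf [set ell y | y in P] = 0) &
      (relatively_D_unstable P ell <-> inf [set ell y | y in P] < 0)].
Proof.
move=> [[S ->] Q0 _] ->; rewrite dual_polytopeE => ricci_ell.
have bP := polyhedron_bounded Q0.
split; [exact: relatively_D_stableP|split|exact: relatively_D_unstableP].
- exact: uniformly_relative_D_stableP.
- exact: non_uniformly_relative_D_stableP.
Qed.
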